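(* For every integer $m\ge 0$, the number of prime factors of $d_m$ is a power of $2$ (that is, equals $2^e$ for some integer $e\ge 0$).
   Context: For positive integers $a,b$ put $Z(a,b):=\dfrac{ab}{(\gcd(a,b))^2}$, which is a positive integer. Let $p_1=2,p_2=3,p_3=5,\dots$ be the increasing sequence of all prime numbers. Define the array of positive integers $a_{m,n}$ ($m\ge 0$, $n\ge 1$) by $a_{0,n}:=p_n$ for $n\ge 1$ and $a_{m+1,n}:=Z(a_{m,n},a_{m,n+1})$ for $m\ge 0$, $n\ge 1$. Let $d_m:=a_{m,1}$ be the first element of row $m$. The number of prime factors of a positive integer $a$ is $\omega(a)$, the number of distinct primes dividing $a$ (all the $a_{m,n}$ are square free, so counting with or without multiplicity is the same). The power $2^0=1$ is allowed. *)

(* Defs.v *)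
From mathcomp Require Import all_boot.

Set Implicit Arguments.
Unset Strict Implicit.
Unset Printing Implicit Defensive.

Definition Z (a b : nat) : nat := (a * b) %/ gcdn a b ^ 2.

Lemma ex_prime_gt (m : nat) : exists p, (m < p) && prime p.
Proof. by have [p lt_mp pr_p] := prime_above m; exists p; rewrite lt_mp. Qed.

(* The least prime greater than m. *)
Definition next_prime (m : nat) : nat := ex_minn (ex_prime_gt m).

(* Indexed from 0: nth_prime n is the (n+1)-st prime p_{n+1}. *)
Fixpoint nth_prime (n : nat) : nat :=
  if n is k.+1 then next_prime (nth_prime k) else 2.

(* Columns are indexed from 0: arr m n is the entry a_{m,n+1} of the array
   whose columns are numbered 1, 2, 3, etc. *)
Fixpoint arr (m n : nat) : nat :=
  if m is k.+1 then Z (arr k n) (arr k n.+1) else nth_prime n.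

Definition d (m : nat) : nat := arr m 0.

Definition omega (a : nat) : nat := size (primes a).

(* Main.v *)
Require Import Defs.
From mathcomp Require Import all_boot.

(** On exponents of a prime [q], the operation [Z] is the distance
    [|x - y|]; on exponents 0 and 1 this is addition modulo 2.  Hence the
    exponents of [q] along the array obey Pascal's rule modulo 2, starting
    from the indicator of [q] in the sequence of primes, and
    [arr m n] is the product of the primes of indices [n + i] such that
    ['C(m, i)] is odd (lemmas [odd_logn_Z], [logn_arr], [perm_primes_arr]).
    So [omega (d m)] counts the odd entries of row [m] of Pascal's triangle.

    By the base 2 case of Lucas' congruence ([odd_bin_double]), row
    [2 * h] has as many odd entries as row [h], and row [2 * h + 1] twice
    as many.  Halving [m] repeatedly therefore shows that the count is a
    power of 2, its exponent being the number of digits 1 of [m] in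
    base 2. *)

(** * The array modulo 2 *)

Lemma dvdn_gcd_sqr_mul (a b : nat) : gcdn a b ^ 2 %| a * b.
Proof. by rewrite -mulnn dvdn_mul ?dvdn_gcdl ?dvdn_gcdr. Qed.

Lemma Z_gt0 (a b : nat) : 0 < a -> 0 < b -> 0 < Z a b.
Proof.
move=> a0 b0; rewrite /Z divn_gt0 ?expn_gt0 ?gcdn_gt0 ?a0 //.
by rewrite dvdn_leq ?muln_gt0 ?a0 ?b0 // dvdn_gcd_sqr_mul.
Qed.

Lemma logn_Z (q a b : nat) : 0 < a -> 0 < b ->
  logn q (Z a b) = logn q a + logn q b - 2 * minn (logn q a) (logn q b).
Proof.
move=> a0 b0.
by rewrite /Z logn_div ?dvdn_gcd_sqr_mul // lognM // lognX logn_gcd.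
Qed.

(** Writing the exponents as parities expresses at once that they are at
    most 1 and that [Z] adds them modulo 2. *)
Lemma odd_logn_Z (q a b x y : nat) : 0 < a -> 0 < b ->
  logn q a = odd x -> logn q b = odd y -> logn q (Z a b) = odd (x + y).
Proof.
move=> a0 b0 qa qb; rewrite logn_Z // qa qb oddD.
by case: (odd x); case: (odd y).
Qed.

Lemma nth_prime_prime (n : nat) : prime (nth_prime n).
Proof.
case: n => [//|n] /=; rewrite /next_prime.
by case: ex_minnP => p /andP[].
Qed.

Lemma nth_prime_inj : injective nth_prime.
Proof.
apply: incn_inj; apply: leq_mono; apply: homo_ltn => [|n /=].
  exact: ltn_trans.
by rewrite /next_prime; case: ex_minnP => p /andP[].
Qed.

Lemma arr_gt0 (m n : nat) : 0 < arr m n.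
Proof.
elim: m n => [|m IHm] n /=; first exact: prime_gt0 (nth_prime_prime n).
exact: Z_gt0.
Qed.

(** Pascal's rule, applied to a row of weights: the combinatorial form of
    [(1 + X) ^ m.+1 = (1 + X) ^ m + X * (1 + X) ^ m]. *)
Lemma sum_binS (f : nat -> nat) (m : nat) :
  \sum_(i < m.+2) 'C(m.+1, i) * f i =
  \sum_(i < m.+1) 'C(m, i) * f i + \sum_(i < m.+1) 'C(m, i) * f i.+1.
Proof.
rewrite big_ord_recl /= bin0.
under eq_bigr => i _ do rewrite /bump /= add1n binS mulnDl.
rewrite big_split addnA /=; congr (_ + _).
by rewrite big_ord_recr /= bin_small // mul0n addn0 [RHS]big_ord_recl bin0.
Qed.

(** The sum has at most one nonzero term, but keeping it as a sum makes the
    formula linear, so that the induction reduces to [sum_binS] for every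
    prime [q] at once. *)
Lemma logn_arr (q m n : nat) : prime q ->
  logn q (arr m n) =
  odd (\sum_(i < m.+1) 'C(m, i) * (nth_prime (n + i) == q)).
Proof.
move=> q_pr; elim: m n => [|m IHm] n /=.
  rewrite big_ord1 bin0 mul1n addn0 oddb.
  by rewrite logn_prime ?nth_prime_prime // eq_sym.
rewrite (sum_binS (fun i => nth_prime (n + i) == q : nat)).
apply: odd_logn_Z; rewrite ?arr_gt0 //.
by rewrite IHm; under eq_bigr => i _ do rewrite addSnnS.
Qed.

Lemma perm_primes_arr (m n : nat) :
  perm_eq (primes (arr m n))
    [seq nth_prime (n + i) | i <- iota 0 m.+1 & odd 'C(m, i)].
Proof.
have inj : injective (fun i => nth_prime (n + i)).
  by move=> i j /nth_prime_inj /addnI.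
apply: uniq_perm; rewrite ?primes_uniq ?(map_inj_uniq inj) //.
  by rewrite filter_uniq // iota_uniq.
move=> q; apply/idP/mapP => [|[i]]; last first.
  rewrite mem_filter mem_iota add0n /= => /andP[odd_i lt_im] ->.
  rewrite -logn_gt0 logn_arr ?nth_prime_prime //.
  rewrite (bigD1 (Ordinal lt_im)) //= eqxx muln1 big1 ?addn0 ?odd_i //.
  by move=> j /negPf; rewrite -val_eqE (inj_eq inj) /= => ->; rewrite muln0.
move=> q_arr; have q_pr : prime q by move: q_arr; rewrite mem_primes => /andP[].
move: q_arr; rewrite -logn_gt0 logn_arr // lt0b => odd_sum.
(* An odd sum has an odd term. *)
have [i odd_i|even_all] := pickP (fun i : 'I_m.+1 =>
    odd ('C(m, i) * (nth_prime (n + i) == q))); last first.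
  move: odd_sum; rewrite (big_morph odd oddD (erefl : odd 0 = false)).
  by rewrite big1.
move: odd_i; rewrite oddM oddb => /andP[odd_i /eqP <-].
by exists (i : nat); rewrite // mem_filter odd_i mem_iota add0n ltn_ord.
Qed.

Lemma omega_arr (m n : nat) :
  omega (arr m n) = \sum_(0 <= i < m.+1) odd 'C(m, i).
Proof.
rewrite /omega (perm_size (perm_primes_arr m n)) size_map size_filter.
by rewrite -sum1_count big_mkcond /= /index_iota subn0.
Qed.

(** * Odd entries in a row of Pascal's triangle *)

(** [(1 + X) ^ 2 = 1 + X ^ 2] modulo 2, read on coefficients. *)
Lemma odd_binSS (n k : nat) :
  odd 'C(n.+2, k.+2) = odd 'C(n, k.+2) (+) odd 'C(n, k).
Proof.
rewrite !binS !oddD.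
by case: (odd 'C(n, k.+2)); case: (odd 'C(n, k.+1)); case: (odd 'C(n, k)).
Qed.

(** Lucas' congruence for the prime 2, one binary digit at a time: the
    factor [c ==> b] is the parity of ['C(b, c)]. *)
Lemma odd_bin_double (i j : nat) (b c : bool) :
  odd 'C(b + i.*2, c + j.*2) = odd 'C(i, j) && (c ==> b).
Proof.
elim: i j => [|i IHi] [|j].
- by case: b; case: c.
- by rewrite !bin_small //; case: b; case: c.
- by case: c {IHi}; rewrite ?bin0 // addn0 bin1 oddD odd_double addbF oddb.
rewrite !doubleS !addnS odd_binSS IHi -!addnS -doubleS IHi binS oddD.
by rewrite andb_addl.
Qed.

(** The upper bound [h.+1.*2] groups the entries of the row in pairs
    [2 * j, 2 * j + 1]; for an even row it includes one trailing zero. *)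
Lemma sum_odd_bin_double (h : nat) (b : bool) :
  \sum_(0 <= i < h.+1.*2) odd 'C(b + h.*2, i) =
  2 ^ b * \sum_(0 <= j < h.+1) odd 'C(h, j).
Proof.
elim: h.+1 => [|k IHk]; first by rewrite !big_nil muln0.
rewrite doubleS !(@big_nat_recr _ _ _ _ 0) //= IHk mulnDr -addnA.
congr (_ + _).
rewrite (odd_bin_double h k b false) (odd_bin_double h k b true).
by case: (odd 'C(h, k)); case: b {IHk}.
Qed.

Lemma sum_odd_bin_pow2 (m : nat) :
  exists e, \sum_(0 <= i < m.+1) odd 'C(m, i) = 2 ^ e.
Proof.
elim/ltn_ind: m => -[|m] IHm; first by exists 0; rewrite big_nat1.
have lt_half : m.+1./2 < m.+1 by rewrite ltn_half_double -addnn ltnS leq_addl.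
have [e row_half] := IHm _ lt_half.
exists (odd m.+1 + e); rewrite expnD -row_half -sum_odd_bin_double.
rewrite odd_double_half doubleS.
have := odd_double_half m.+1.
case: (odd m.+1); first by rewrite add1n => -[->].
rewrite add0n => ->.
(* In an even row, the range on the right has one more entry, a zero. *)
by rewrite [RHS](@big_nat_recr _ _ _ _ 0) //= bin_small // addn0.
Qed.

Theorem theorem1 (m : nat) : exists e : nat, omega (d m) = 2 ^ e.
Proof.
by have [e row_m] := sum_odd_bin_pow2 m; exists e; rewrite /d omega_arr.
Qed.
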